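(* Let $G$ and $H$ be two graphs and let $U$ be a quantum isomorphism from $G$ to $H$. Let $I=r_G(V(G))$, and for $i\in I$ let $C_i=r_G^{-1}(\{i\})\subset V(G)$ and $D_i=r_H^{-1}(\{i\})\subset V(H)$. For $i,j\in I$ let $U_{ij}$ be the block of $U$ indexed by $D_i\times C_j$, and write $U_i=U_{ii}$. Then, for all $i,j\in I$: (1) $U_{ij}=0$ if $i\neq j$; (2) $\# C_i=\# D_i$; (3) $U_i$ is a quantum isomorphism from the induced subgraph $G[C_i]$ to the induced subgraph $H[D_i]$. In particular, letting $i_0=\min r_G(V(G))$, the block $U_{i_0}$ is a quantum isomorphism from $Z(G)$ to $Z(H)$.
   Context: Graphs are finite, simple and undirected, with at least one vertex. For a graph $G$, $d_G(x,y)\in\mathbb N\cup\{\infty\}$ is the graph distance ($\infty$ if $x,y$ lie in different connected components), and $r_G(x)=\sup_{y\in V(G)} d_G(x,y)$ for $x\in V(G)$. The center of $G$ is $Z(G)=\{x\in V(G)\mid r_G(x)\text{ is minimal}\}$, also viewed as the subgraph of $G$ induced on this set. Unital $C^*$-algebras are assumed nonzero. A magic unitary with coefficients in a unital $C^*$-algebra $X$ is a square matrix with entries in $X$ that are self-adjoint projections such that each row and each column sums to $1_X$. A quantum isomorphism from $G$ to $H$ is a magic unitary $U$ (with coefficients in some unital $C^*$-algebra), with rows indexed by $V(H)$ and columns indexed by $V(G)$, such that $U\,\mathrm{Adj}(G)=\mathrm{Adj}(H)\,U$, where $\mathrm{Adj}$ denotes the adjacency matrix (in particular $\#V(G)=\#V(H)$).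 *)

(* Defs.v *)
From HB Require Import structures.
From mathcomp Require Import all_boot all_order all_algebra.
From mathcomp Require Import complex.
From mathcomp Require Import all_classical all_reals ereal.

Set Implicit Arguments.
Unset Strict Implicit.
Unset Printing Implicit Defensive.

Import Order.TTheory GRing.Theory Num.Theory.

Local Open Scope ring_scope.

(* The library's normed modules cannot be joined with its non-integral rings
   ([numDomainType] would have to inherit from the join), so the norm and its
   completeness are fields here. Nonzeroness is inherited: [algType] extends
   [nzRingType]. *)
HB.mixin Record isUnitalCStar (R : realType) A of GRing.Algebra R[i] A := {
  star : A -> A;
  starD : forall a b : A, star (a + b) = star a + star b;
  starZ : forall (k : R[i]) (a : A), star (k *: a) = Num.conj k *: star a;
  starM : forall a b : A, star (a * b) = star b * star a;
  starK : forall a : A, star (star a) = a;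
  cstar_norm : A -> R;
  cstar_norm_ge0 : forall a : A, 0 <= cstar_norm a;
  cstar_norm0_eq0 : forall a : A, cstar_norm a = 0 -> a = 0;
  cstar_normD : forall a b : A, cstar_norm (a + b) <= cstar_norm a + cstar_norm b;
  cstar_normZ : forall (k : R[i]) (a : A),
    cstar_norm (k *: a) = complex.Re `|k| * cstar_norm a;
  cstar_normM : forall a b : A, cstar_norm (a * b) <= cstar_norm a * cstar_norm b;
  cstar_norm_star : forall a : A, cstar_norm (star a * a) = cstar_norm a ^+ 2;
  cstar_complete : forall u : nat -> A,
    (forall e : R, 0 < e -> exists N, forall m n : nat,
       (N <= m)%N -> (N <= n)%N -> cstar_norm (u m - u n) < e) ->
    exists l : A, forall e : R, 0 < e -> exists N, forall n : nat,
       (N <= n)%N -> cstar_norm (u n - l) < e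
}.

#[short(type="unitalCStarType")]
HB.structure Definition UnitalCStar (R : realType) :=
  {A of isUnitalCStar R A & GRing.Algebra R[i] A}.

(* Vertex-free graphs are allowed here so that every induced subgraph is a graph;
   nonemptiness is a separate hypothesis. *)
Record sgraph := SGraph {
  vertex :> finType;
  edge : rel vertex;
  edge_sym : symmetric edge;
  edge_irrefl : irreflexive edge
}.

Section Induced.
Variables (G : sgraph) (S : {set G}).

Definition induced_edge : rel {x : G | x \in S} :=
  fun x y => edge (val x) (val y).

Lemma induced_edge_sym : symmetric induced_edge.
Proof. by move=> x y; apply: edge_sym. Qed.

Lemma induced_edge_irrefl : irreflexive induced_edge.
Proof. by move=> x; apply: edge_irrefl. Qed.

Definition induced : sgraph := SGraph induced_edge_sym induced_edge_irrefl.

End Induced.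

Section Distance.
Variables (R : realType) (G : sgraph).

Definition walk_from_to (x y : G) : set (seq G) :=
  [set p | path (@edge G) x p /\ last x p = y]%classic.

(* The infimum of the empty set is +oo, so this is +oo when no walk joins x to y. *)
Definition dist (x y : G) : \bar R :=
  ereal_inf [set (size p)%:R%:E | p in walk_from_to x y]%classic.

Definition ecc (x : G) : \bar R := ereal_sup (range (dist x)).

Definition ecc_level (i : \bar R) : {set G} := [set x | ecc x == i]%SET.

Definition min_ecc : \bar R := \big[Order.min/+oo%E]_(x : G) ecc x.

Definition center : {set G} := [set x | [forall y, (ecc x <= ecc y)%E]]%SET.

End Distance.

Arguments ecc_level {R} G i.

(* Matrices whose rows and columns are indexed by arbitrary finite types are
   functions M, with M i j the entry in row i and column j. *)
Section Matrices.
Variables (R : realType) (A : unitalCStarType R).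

Definition mulfm (I J K : finType) (M : I -> J -> A) (N : J -> K -> A) :
    I -> K -> A :=
  fun i k => \sum_j M i j * N j k.

Definition adj (G : sgraph) : G -> G -> A := fun x y => (edge x y)%:R.

Definition block (I J : finType) (M : I -> J -> A)
    (S : {set I}) (T : {set J}) :
    {i : I | i \in S} -> {j : J | j \in T} -> A :=
  fun i j => M (val i) (val j).

Definition is_projection (p : A) : Prop := star p = p /\ p * p = p.

Record magic_unitary (I J : finType) (U : I -> J -> A) : Prop := {
  magic_square : #|I| = #|J|;
  magic_proj : forall i j, is_projection (U i j);
  magic_row : forall i, \sum_j U i j = 1;
  magic_col : forall j, \sum_i U i j = 1
}.

Definition quantum_iso (G H : sgraph) (U : H -> G -> A) : Prop :=
  magic_unitary U /\ mulfm U (@adj G) =2 mulfm (@adj H) U.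

End Matrices.

Arguments quantum_iso {R A} G H U.
Arguments block {R A I J} M S T i j.

(* Main.v *)
(* Quantum isomorphisms intertwine walk counts: [U] intertwines all powers of the
   adjacency matrices. Since the entries in a row or a column of [U] are
   orthogonal, [U h g * U h' g' <> 0] forces [g, g'] and [h, h'] to have the same
   number of walks of every length, hence the same distance. As rows and columns
   sum to 1, [U h g <> 0] then forces [ecc g = ecc h], so [U] is block diagonal
   along the level sets of the eccentricity, and each diagonal block is again a
   quantum isomorphism.

   Orthogonality of projections [p i] summing to 1 is obtained without functional
   calculus. The elements [p j * p i * p j], for [i <> j], sum to 0, and positivity
   is expressed by norm bounds in the corner of [p j]; so it suffices that a
   self-adjoint [a] in the corner of a projection [e] with [|e + a| <= 1] and
   [|e - a| <= 1] vanishes (the unit of a C*-algebra is an extreme point of the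
   unit ball). By the C*-identity [|e + w a| <= 1] for all [|w| = 1], and a Cauchy
   estimate on [(e + w a) ^ n] gives [n |a| <= 1] for arbitrarily large [n]. *)
Require Import Defs.
From mathcomp Require Import all_boot all_order all_algebra.
From mathcomp Require Import complex.
From mathcomp Require Import all_classical all_reals ereal.
From mathcomp Require Import zify ring lra.

Set Implicit Arguments.
Unset Strict Implicit.
Unset Printing Implicit Defensive.

Import Order.TTheory GRing.Theory Num.Theory.

Local Open Scope ring_scope.

(** * Roots of unity *)

(** A [2 ^ k]-th root of [-1] has order dividing [2 ^ k.+1] but not [2 ^ k]. Powers of 2 suffice,
    since only arbitrarily large orders are needed. *)
Lemma prim_root_pow2 (F : numClosedFieldType) k :
  exists z : F, (2 ^ k.+1).-primitive_root z.
Proof.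
have n_gt0 : (0 < 2 ^ k)%N by rewrite expn_gt0.
pose z : F := (2 ^ k).-root (-1); have zN1 : z ^+ (2 ^ k) = -1 by apply: rootCK.
have z1 : z ^+ (2 ^ k.+1) = 1 by rewrite expnSr exprM zN1 sqrrN expr1n.
have [|m] := prim_order_exists _ z1; first by rewrite expn_gt0.
move=> prim_z /dvdn_pfactor - /(_ isT) [j le_jk def_m].
rewrite leq_eqVlt ltnS in le_jk.
case/predU1P: le_jk => [<-|le_jk]; first by exists z; rewrite -def_m.
have: z ^+ (2 ^ k) == 1 by rewrite -(prim_order_dvd prim_z) def_m dvdn_exp2l.
by rewrite zN1 eq_sym -subr_eq0 opprK (pnatr_eq0 F 2).
Qed.

Lemma sum_prim_root (F : fieldType) n m (z : F) :
  n.-primitive_root z ->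
  \sum_(l < n) (z ^+ m) ^+ l = if (n %| m)%N then n%:R else 0.
Proof.
move=> prim_z; rewrite (prim_order_dvd prim_z); case: eqP => [->|/eqP zm1].
  by rewrite (eq_bigr (fun=> 1)) ?sumr_const ?card_ord // => l _; apply: expr1n.
apply: (mulfI (x := z ^+ m - 1)); first by rewrite subr_eq0.
by rewrite -subrX1 exprAC (prim_expr_order prim_z) expr1n subrr mulr0.
Qed.

(** * Norm and involution in a C*-algebra *)

Section CStarNorm.
Variables (R : realType) (A : unitalCStarType R).
Implicit Types (a b e : A) (k : R[i]).
Local Notation nrm := (@cstar_norm R A).

Lemma star0 : star (0 : A) = 0.
Proof. by apply: (addrI (star (0 : A))); rewrite -starD !addr0. Qed.

Lemma starN a : star (- a) = - star a.
Proof. by apply: (addrI (star a)); rewrite -starD !subrr star0. Qed.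

Lemma star1 : star (1 : A) = 1.
Proof. by rewrite -[LHS]mul1r -{1}[1]starK -starM mul1r starK. Qed.

Lemma cstar_norm0 : nrm 0 = 0.
Proof. by rewrite -(scale0r (0 : A)) cstar_normZ normr0 mul0r. Qed.

Lemma cstar_norm1 : nrm 1 = 1.
Proof.
have n1_neq0 : nrm 1 != 0.
  by apply/eqP => /cstar_norm0_eq0/eqP; rewrite oner_eq0.
have := cstar_norm_star (1 : A); rewrite star1 mulr1 expr2 => n1.
by apply: (mulfI n1_neq0); rewrite -n1 mulr1.
Qed.

Lemma cstar_norm_unit k a : `|k| = 1 -> nrm (k *: a) = nrm a.
Proof. by move=> k1; rewrite cstar_normZ k1 mul1r. Qed.

Lemma cstar_normN a : nrm (- a) = nrm a.
Proof. by rewrite -scaleN1r cstar_norm_unit ?normrN1. Qed.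

Lemma cstar_normMn a n : nrm (a *+ n) = nrm a *+ n.
Proof.
rewrite -scaler_nat cstar_normZ normr_nat -(mulr_natl (nrm a)); congr (_ * _).
by rewrite -(rmorph_nat (real_complex R)).
Qed.

Lemma cstar_norm_sum (I : Type) (r : seq I) (P : pred I) (F : I -> A) :
  nrm (\sum_(i <- r | P i) F i) <= \sum_(i <- r | P i) nrm (F i).
Proof.
elim/big_rec2: _ => [|i x y _ le_yx]; first by rewrite cstar_norm0.
by apply: le_trans (cstar_normD _ _) _; rewrite lerD2l.
Qed.

Lemma cstar_normX_le1 a n : nrm a <= 1 -> nrm (a ^+ n) <= 1.
Proof.
move=> a1; elim: n => [|n IHn]; first by rewrite cstar_norm1.
rewrite exprS; apply: le_trans (cstar_normM _ _) _.
by rewrite mulr_ile1 ?cstar_norm_ge0.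
Qed.

Lemma cstar_norm_conv a b (x y : R) :
  0 <= x -> 0 <= y -> x + y = 1 -> nrm a <= 1 -> nrm b <= 1 ->
  nrm (x%:C%C *: a + y%:C%C *: b) <= 1.
Proof.
move=> x0 y0 xy1 a1 b1; apply: le_trans (cstar_normD _ _) _.
rewrite !cstar_normZ !ger0_norm ?lecR //= -xy1.
by apply: lerD; rewrite ler_piMr.
Qed.

Lemma star_mul_eq0 a : star a * a = 0 -> a = 0.
Proof.
move=> aa0; apply: cstar_norm0_eq0; apply/eqP.
by rewrite -sqrf_eq0 -cstar_norm_star aa0 cstar_norm0.
Qed.

Lemma cstar_norm_projection e : is_projection e -> nrm e <= 1.
Proof.
case=> eS ee; have := cstar_norm_star e; rewrite eS ee.
by have := cstar_norm_ge0 e; nra.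
Qed.

(** The element is a self-adjoint unitary, so the C*-identity applies to its square [1]. *)
Lemma cstar_norm_reflection e : is_projection e -> nrm (1 - e *+ 2) <= 1.
Proof.
case=> eS ee; have := cstar_norm_star (e *+ 2 - 1).
rewrite starD starN star1 mulr2n starD eS -mulr2n -expr2 sqrrB1 exprMn_n.
rewrite expr2 ee -mulrnA subrr add0r cstar_norm1 -cstar_normN opprB.
by have := cstar_norm_ge0 (1 - e *+ 2); nra.
Qed.

(** * Extremality of a projection in its corner, and orthogonality of partitions of unity *)

Section Corner.
Variables (e a : A).
Hypotheses (e_proj : is_projection e) (aS : star a = a).
Hypotheses (ea : e * a = a) (ae : a * e = a).
Hypotheses (le1D : nrm (e + a) <= 1) (le1B : nrm (e - a) <= 1).

(** With [c] the real part of [k], the product of [e + k *: a] by its adjoint on the left is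
    [e + a * a + 2 c a], the convex combination of [(e + a) ^+ 2] and [(e - a) ^+ 2] with weights
    [(1 + c) / 2] and [(1 - c) / 2]. *)
Lemma cstar_norm_circle k : `|k| = 1 -> nrm (e + k *: a) <= 1.
Proof.
case: e_proj => eS ee k1.
suff: nrm (e + k *: a) ^+ 2 <= 1 by rewrite expr_le1 ?cstar_norm_ge0.
pose c := complex.Re k.
have kJ : k^* = c%:C%C *+ 2 - k.
  by rewrite -mulr_natl -[2%:R]/(2%:R : R[i]) -addcJ addrAC subrr add0r.
have kk : k^* * k = 1 by rewrite mulrC -normCK k1 expr1n.
have cle1 : - 1 <= c <= 1.
  rewrite -ler_norml; have := normc_ge_Re k.
  by rewrite k1 -[1]/(1%:C%C) lecR.
have := @cstar_norm_conv ((e + a) ^+ 2) ((e - a) ^+ 2) ((1 + c) / 2) ((1 - c) / 2).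
move=> /(_ _ _ _ (cstar_normX_le1 _ le1D) (cstar_normX_le1 _ le1B)) le1.
rewrite -cstar_norm_star (_ : _ * _ =
    ((1 + c) / 2)%:C%C *: (e + a) ^+ 2 + ((1 - c) / 2)%:C%C *: (e - a) ^+ 2).
  by apply: le1; lra.
have -> : (e + a) ^+ 2 = e + a * a + a *+ 2.
  by rewrite expr2 mulrDl !mulrDr ee ea ae mulr2n -!addrA; congr (_ + _);
    rewrite addrC -!addrA addrC addrA.
have -> : (e - a) ^+ 2 = e + a * a - a *+ 2.
  rewrite expr2 mulrBl !mulrBr ee ea ae mulr2n opprB opprD.
  by rewrite -!addrA; congr (_ + _); rewrite addrCA addrC -!addrA.
rewrite starD starZ eS aS mulrDl !mulrDr ee -scalerAr -!scalerAl ea ae -scalerAr.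
rewrite scalerA kk scale1r.
set s := e + a * a; rewrite -/s.
have -> : e + k *: a + (k^* *: a + a * a) = s + (k + k^* ) *: a.
  by rewrite [_ + a * a]addrC addrACA -scalerDl.
rewrite scalerDr scalerBr addrACA -scalerDl -scalerBl -rmorphD -rmorphB /=.
rewrite (_ : (1 + c) / 2 + _ = 1) ?scale1r; last by field.
rewrite (_ : (1 + c) / 2 - _ = c); last by field.
by rewrite kJ addrCA subrr addr0 -scalerMnl scalerMnr.
Qed.

(* A unitary Cauchy estimate: averaging the contractions [(e + w a) ^ n] against
   [w^-1] over the [n]-th roots of unity [w] isolates the linear term [n a]. *)
Lemma cstar_norm_extreme_bound (k : nat) : nrm a *+ (2 ^ k.+1) <= 1.
Proof.
case: e_proj => eS ee; have [z prim_z] := prim_root_pow2 R[i] k.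
move: (2 ^ k.+1)%N (expn_gt0 2 k.+1) (@leq_pexp2l 2 1 k.+1 isT isT) prim_z.
rewrite expn1 => n n_gt0 n_gt1 prim_z.
have z1 l : `|z ^+ l| = 1.
  have : `|z| ^+ n == 1 by rewrite -normrX (prim_expr_order prim_z) normr1.
  rewrite normrX pexpr_eq1 ?normr_ge0 // => /eqP ->; apply: expr1n.
have expn l : (e + z ^+ l *: a) ^+ n =
    \sum_(i < n.+1) z ^+ (l * i) *: (e * a ^+ i) *+ 'C(n, i).
  (* Factoring out the idempotent [e] reduces the power to the binomial formula for
     [z ^+ l *: a + 1]. *)
  have -> : e + z ^+ l *: a = e * (z ^+ l *: a + 1).
    by rewrite mulrDr -scalerAr ea mulr1 addrC.
  rewrite exprMn_comm; last first.
    by rewrite /GRing.comm mulrDr mulrDl mulr1 mul1r -scalerAr -scalerAl ea ae.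
  have -> : e ^+ n = e.
    case: n n_gt0 {n_gt1 prim_z} => // n _.
    by elim: n => // n IHn; rewrite exprS IHn.
  rewrite exprD1n mulr_sumr; apply: eq_bigr => i _.
  by rewrite exprZn mulrnAr -scalerAr exprM.
have avg : \sum_(l < n) (z ^+ n.-1) ^+ l *: (e + z ^+ l *: a) ^+ n = a *+ (n * n).
  have coef (i : 'I_n.+1) :
      \sum_(l < n) (z ^+ n.-1) ^+ l *: (z ^+ (l * i) *: (e * a ^+ i) *+ 'C(n, i)) =
      (if (n %| n.-1 + i)%N then n%:R else 0) *: (e * a ^+ i) *+ 'C(n, i).
    rewrite -(sum_prim_root _ prim_z) scaler_suml -sumrMnl; apply: eq_bigr => l _.
    by rewrite -scalerMnr scalerA -!exprM -exprD mulnDl [(i * l)%N]mulnC.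
  under eq_bigr do rewrite expn scaler_sumr.
  rewrite exchange_big (eq_bigr _ (fun i _ => coef i)) /=.
  (* As [i <= n] and [n > 1], [n] divides [n.-1 + i] only for [i = 1]. *)
  rewrite (bigD1 (Ordinal (leqW n_gt1))) //= big1 => [|i ni1].
    by rewrite addr0 addn1 prednK // dvdnn bin1 expr1 ea scaler_nat mulrnA.
  case: ifP => [/dvdnP[q def_i]|]; last by rewrite scale0r mul0rn.
  case/eqP: ni1; apply: val_inj => /=.
  have := ltn_ord i; case: q def_i => [|[|q]]; nia.
have : nrm (a *+ (n * n)) <= n%:R.
  rewrite -avg; apply: le_trans (cstar_norm_sum _ _ _) _.
  rewrite -[leRHS]mulr1 mulr_natl -[n in leRHS]card_ord -sumr_const.
  apply: ler_sum => l _.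
  by rewrite cstar_norm_unit -?exprM // cstar_normX_le1 // cstar_norm_circle.
rewrite cstar_normMn mulrnA -[nrm a *+ n *+ n]mulr_natr -{2}[n%:R]mul1r.
by rewrite ler_pM2r // ltr0n.
Qed.

Lemma cstar_norm_extreme : a = 0.
Proof.
apply/cstar_norm0_eq0/eqP; rewrite eq_le cstar_norm_ge0 andbT leNgt.
apply/negP => a_gt0.
have := archi_boundP (ltW (divr_gt0 ltr01 a_gt0)); set m := Num.bound _ => lt_m.
have := cstar_norm_extreme_bound m; apply/negP; rewrite -ltNge.
rewrite -mulr_natr -ltr_pdivrMl // mulrC; apply: lt_le_trans lt_m _.
by rewrite ler_nat ltnW // ltnW // ltn_expl.
Qed.

End Corner.

(* The bound [|e - a i| <= 1] encodes positivity of [a i]: if the others sum to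
   [- a i], then [|t e + a i|] and [|t e - a i|] are both at most [t] for [t = #|P|]. *)
Lemma corner_sum_eq0 (I : finType) (P : pred I) (e : A) (a : I -> A) :
  is_projection e -> (forall i, star (a i) = a i) ->
  (forall i, e * a i = a i) -> (forall i, a i * e = a i) ->
  (forall i, nrm (e - a i) <= 1) ->
  \sum_(i | P i) a i = 0 -> forall i, P i -> a i = 0.
Proof.
move=> e_proj aS ea ae le1 sum0 i Pi.
have [m def_m] : exists m, #|P| = m.+1.
  by exists #|P|.-1; rewrite prednK //; apply/card_gt0P; exists i.
pose t : R[i] := m.+1%:R.
have t_neq0 : t != 0 by rewrite pnatr_eq0.
have normV b : nrm b <= m.+1%:R -> nrm (t^-1 *: b) <= 1.
  move=> le_bm; rewrite cstar_normZ normfV normr_nat.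
  have -> : t^-1 = (m.+1%:R^-1 : R)%:C%C by rewrite fmorphV rmorph_nat.
  by rewrite /= mulrC ler_pdivrMr ?mul1r ?ltr0n.
have teK b : t^-1 *: (e *+ m.+1 + b) = e + t^-1 *: b.
  by rewrite scalerDr -scaler_nat scalerA mulVf // scale1r.
have e1 : nrm e <= 1 by apply: cstar_norm_projection.
suff: t^-1 *: a i = 0.
  by move/eqP; rewrite scaler_eq0 invr_eq0 (negPf t_neq0) => /eqP.
apply: (cstar_norm_extreme e_proj).
- by rewrite starZ aS fmorphV rmorph_nat.
- by rewrite -scalerAr ea.
- by rewrite -scalerAl ae.
- rewrite -teK; apply: normV.
  (* A sum of [m.+1] contractions, because [a i] is minus the sum of the other [m] terms. *)
  have -> : e *+ m.+1 + a i = e + \sum_(j | P j && (j != i)) (e - a j).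
    move/eqP: sum0; rewrite (bigD1 i) //= addr_eq0 => /eqP ->.
    rewrite sumrB mulrS addrA; congr (_ + _ - _); rewrite sumr_const.
    by congr (_ *+ _); move: def_m; rewrite (cardD1x Pi) => -[<-].
  rewrite mulrS; apply: le_trans (cstar_normD _ _) _; apply: lerD => //.
  apply: le_trans (cstar_norm_sum _ _ _) _.
  apply: (@le_trans _ _ (\sum_(j | P j && (j != i)) 1)).
    by apply: ler_sum => j _; apply: le1.
  by rewrite sumr_const ler_nat; move: def_m; rewrite (cardD1x Pi) => -[<-].
- rewrite -scalerN -teK; apply: normV.
  rewrite mulrSr -addrA mulrSr; apply: le_trans (cstar_normD _ _) _.
  by apply: lerD => //; rewrite cstar_normMn lerMn2r e1 orbT.
Qed.

(** The elements [2 p_i p_l p_i], for [l != i], sum to [2 p_i (1 - p_i) p_i = 0]. The factor 2 gives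
    the norm bound: [p_i - 2 p_i p_l p_i = p_i (1 - 2 p_l) p_i] compresses a reflection. Each
    element thus vanishes, and [p_i p_j p_i] is the star-square of [p_j p_i]. *)
Lemma projection_partition_orth (I : finType) (p : I -> A) :
  (forall i, is_projection (p i)) -> \sum_i p i = 1 ->
  forall i j, i != j -> p i * p j = 0.
Proof.
move=> p_proj sum1 i j ij; have [iS ii] := p_proj i; have [jS jj] := p_proj j.
have le_pi1 : nrm (p i) <= 1 by apply: cstar_norm_projection.
suff /eqP: (p i * p j * p i) *+ 2 = 0.
  rewrite -scaler_nat scaler_eq0 pnatr_eq0 => /eqP pij0.
  have ji0 : p j * p i = 0.
    by apply: star_mul_eq0; rewrite starM iS jS mulrA -[_ * p j * p j]mulrA jj.
  by rewrite -[LHS]starK starM iS jS ji0 star0.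
apply: (@corner_sum_eq0 I (fun l => l != i) (p i)
  (fun l => (p i * p l * p i) *+ 2) _ _ _ _ _ _ j).
- by [].
- by move=> k; rewrite mulr2n starD !starM iS (p_proj k).1 mulrA.
- by move=> k; rewrite mulrnAr !mulrA ii.
- by move=> k; rewrite mulrnAl -!mulrA ii.
- move=> k; have -> : p i - (p i * p k * p i) *+ 2 = p i * (1 - p k *+ 2) * p i.
    by rewrite mulrBr mulrBl mulr1 ii mulrnAr mulrnAl.
  have u := cstar_norm_reflection (p_proj k).
  by do 2![apply: le_trans (cstar_normM _ _) _; rewrite mulr_ile1 ?cstar_norm_ge0 //].
- rewrite sumrMnl -mulr_suml -mulr_sumr.
  move/eqP: sum1; rewrite (bigD1 i) //= addrC eq_sym -subr_eq => /eqP <-.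
  by rewrite mulrBr mulr1 ii subrr mul0r mul0rn.
- by rewrite eq_sym.
Qed.

End CStarNorm.

(** * Walk counts and distance *)

(** The entries of the [k]-th power of the adjacency matrix. *)
Fixpoint nwalks (G : sgraph) (k : nat) (x y : G) : nat :=
  if k is k'.+1 then \sum_z edge x z * nwalks k' z y else x == y.

Lemma nwalks_gt0 (G : sgraph) k (x y : G) :
  (0 < nwalks k x y)%N <-> exists2 p, walk_from_to x y p & size p = k.
Proof.
elim: k x => [|k IHk] x /=.
  rewrite lt0b; split=> [/eqP <-|[[|//] [_ /= ->]] //]; by exists [::].
rewrite lt0n sum_nat_eq0 negb_forall; split.
  case/existsP=> z; rewrite -lt0n muln_gt0 lt0b => /andP[xz /IHk[p [zp lastp] sp]].
  by exists (z :: p); rewrite /= ?sp //; split=> //=; rewrite xz.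
case=> -[|z p] //= [/= /andP[xz zp] lastp] [sp].
apply/existsP; exists z; rewrite -lt0n muln_gt0 lt0b xz.
by apply/IHk; exists p.
Qed.

(** The distance is the infimum of the [k] with a positive walk count. *)
Lemma eq_dist (R : realType) (G H : sgraph) (x y : G) (x' y' : H) :
  (forall k, nwalks k x y = nwalks k x' y') -> dist R x y = dist R x' y'.
Proof.
move=> eq_nw; rewrite /dist; congr ereal_inf.
suff sub (G1 G2 : sgraph) (u v : G1) (u' v' : G2) :
    (forall k, nwalks k u v = nwalks k u' v') ->
    ([set ((size p)%:R : R)%:E | p in walk_from_to u v] `<=`
     [set ((size p)%:R : R)%:E | p in walk_from_to u' v'])%classic.
  by apply/seteqP; split; apply: sub.
move=> eq_uv _ [p uvp <-].
have /nwalks_gt0[q u'v'q szq] : (0 < nwalks (size p) u' v')%N.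
  by rewrite -eq_uv; apply/nwalks_gt0; exists p.
by exists q => //; rewrite szq.
Qed.

Lemma mul_partition_neq0 (A : nzRingType) (I : finType) (a : A) (F : I -> A) :
  a != 0 -> \sum_i F i = 1 -> exists i, a * F i != 0.
Proof.
move=> a0 sum1; apply/existsP; apply: contraNT a0.
rewrite negb_exists => /forallP aF0.
rewrite -[a]mulr1 -sum1 mulr_sumr big1 // => i _.
by apply/eqP; rewrite -[_ == _]negbK.
Qed.

(** * Minimal eccentricity and the center *)

Lemma min_ecc_attained (R : realType) (G : sgraph) :
  (0 < #|G|)%N -> exists x : G, min_ecc R G = ecc R x.
Proof.
move=> /card_gt0P[x0 _].
(* The default [+oo] bounds every eccentricity, so the minimum over a nonempty graph is attained at
   a vertex. *)
have le_ecc x : xpredT x -> (@ecc R G x <= +oo)%E by rewrite leey.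
by have [x _ min_x] := eq_bigmin x0 xpredT (@ecc R G) isT le_ecc; exists x.
Qed.

Lemma min_ecc_le (R : realType) (G : sgraph) (x : G) : (min_ecc R G <= ecc R x)%E.
Proof. exact: bigmin_le. Qed.

Lemma ecc_level_min_ecc (R : realType) (G : sgraph) :
  (0 < #|G|)%N -> ecc_level G (min_ecc R G) = center R G.
Proof.
move=> /(min_ecc_attained R)[x0 min_x0].
apply/setP=> x; rewrite !inE; apply/eqP/forallP => [-> y|le_x].
  exact: min_ecc_le.
by apply: le_anti; rewrite min_ecc_le min_x0 le_x.
Qed.

(** * Invariance of walk counts, distance and eccentricity *)

Section QuantumIso.
Variables (R : realType) (A : unitalCStarType R) (G H : sgraph).
Variable U : H -> G -> A.
Hypothesis hU : quantum_iso G H U.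

(** Entrywise form of [U Adj(G)^k = Adj(H)^k U]; the induction moves one adjacency factor across [U]
    at a time. *)
Lemma intertwine_nwalks k h g :
  \sum_x U h x * (nwalks k x g)%:R = \sum_y (nwalks k h y)%:R * U y g.
Proof.
elim: k h => [|k IHk] h /=.
  rewrite (bigD1 g) //= eqxx mulr1 big1 => [|x /negPf ->]; last by rewrite mulr0.
  rewrite [RHS](bigD1 h) //= eqxx mul1r big1 // => y.
  by rewrite eq_sym => /negPf ->; rewrite mul0r.
transitivity (\sum_z mulfm U (@adj R A G) h z * (nwalks k z g)%:R).
  under eq_bigr do rewrite natr_sum mulr_sumr.
  rewrite exchange_big; apply: eq_bigr => z _; rewrite mulr_suml.
  by apply: eq_bigr => x _; rewrite natrM mulrA.
under [LHS]eq_bigr do rewrite hU.2 mulr_suml.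
rewrite exchange_big /=.
transitivity (\sum_y adj A h y * \sum_z U y z * (nwalks k z g)%:R).
  by apply: eq_bigr => y _; rewrite mulr_sumr; apply: eq_bigr => z _; rewrite mulrA.
under [LHS]eq_bigr do rewrite IHk mulr_sumr.
rewrite exchange_big; apply: eq_bigr => z _; rewrite natr_sum mulr_suml.
by apply: eq_bigr => y _; rewrite natrM mulrA.
Qed.

Lemma magic_row_orth h g g' : g != g' -> U h g * U h g' = 0.
Proof.
have [[_ proj row _] _] := hU.
exact: projection_partition_orth (proj h) (row h) g g'.
Qed.

Lemma magic_col_orth g h h' : h != h' -> U h g * U h' g = 0.
Proof.
have [[_ proj _ col] _] := hU.
exact: (projection_partition_orth (p := U^~ g)) (fun i => proj i g) (col g) h h'.
Qed.

Lemma mulrn_inj (x : A) m n : x != 0 -> x *+ m = x *+ n -> m = n.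
Proof.
move=> x0 /eqP; rewrite -(scaler_nat m) -(scaler_nat n) -subr_eq0 -scalerBl.
rewrite scaler_eq0 (negPf x0) orbF.
by rewrite subr_eq0 eqr_nat => /eqP.
Qed.

Lemma nwalks_quantum_iso g g' h h' k :
  U h g * U h' g' != 0 -> nwalks k g g' = nwalks k h h'.
Proof.
have [[_ proj _ _] _] := hU.
move=> UU0; apply: (mulrn_inj UU0).
(* Between these two factors, row orthogonality leaves only [x = g] on the left side and column
   orthogonality only [y = h'] on the right. *)
have := congr1 (fun x => U h g * x * U h' g') (intertwine_nwalks k h g').
rewrite !mulr_sumr !mulr_suml (bigD1 g) //= big1 => [|x gx]; last first.
  by rewrite !mulrA magic_row_orth ?mul0r // eq_sym.
rewrite [RHS](bigD1 h') //= [in RHS]big1 => [|y hy]; last first.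
  by rewrite -!mulrA magic_col_orth ?mulr0.
rewrite !addr0 mulrA (proj h g).2 -!mulrA (proj h' g').2.
by rewrite mulr_natl mulrnAr mulr_natl mulrnAr.
Qed.

Lemma dist_quantum_iso g g' h h' :
  U h g * U h' g' != 0 -> dist R g g' = dist R h h'.
Proof. by move=> UU0; apply: eq_dist => k; apply: nwalks_quantum_iso UU0. Qed.

(** Since each column sums to 1, every [y] in [G] has an [h'] with [U h g * U h' y != 0], so each
    distance from [g] is one from [h]; rows give the converse. *)
Lemma ecc_quantum_iso h g : U h g != 0 -> ecc R g = ecc R h.
Proof.
have [[_ _ row col] _] := hU.
move=> Uhg; rewrite /ecc; congr ereal_sup.
apply/seteqP; split=> [_ [y _ <-]|_ [y _ <-]].
  have [h' UU0] := mul_partition_neq0 Uhg (col y).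
  by exists h' => //; rewrite (dist_quantum_iso UU0).
have [g' UU0] := mul_partition_neq0 Uhg (row y).
by exists g' => //; rewrite (dist_quantum_iso UU0).
Qed.

Lemma min_ecc_quantum_iso :
  (0 < #|G|)%N -> (0 < #|H|)%N -> min_ecc R G = min_ecc R H.
Proof.
have [[_ _ row col] _] := hU.
move=> /(min_ecc_attained R)[g min_g] /(min_ecc_attained R)[h min_h].
apply: le_anti; apply/andP; split.
  have [g' Uhg'] := mul_partition_neq0 (oner_neq0 A) (row h).
  by rewrite mul1r in Uhg'; rewrite min_h -(ecc_quantum_iso Uhg') min_ecc_le.
have [h' Uh'g] := mul_partition_neq0 (oner_neq0 A) (col g).
by rewrite mul1r in Uh'g; rewrite min_g (ecc_quantum_iso Uh'g) min_ecc_le.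
Qed.

(** * Diagonal blocks *)

Section Block.
Variables (S : {set G}) (T : {set H}).
Hypothesis UST : forall h g, U h g != 0 -> (g \in S) = (h \in T).

Lemma magic_block0 h g : (g \in S) != (h \in T) -> U h g = 0.
Proof. by move=> ST; apply/eqP; apply: contraNT ST => /UST ->. Qed.

Lemma sum_row_block h (F : G -> A) : h \in T ->
  \sum_(g in S) U h g * F g = \sum_g U h g * F g.
Proof.
move=> hT; rewrite [RHS](bigID (mem S)) /= [X in _ + X]big1 ?addr0 // => g gS.
by rewrite magic_block0 ?mul0r // hT (negPf gS).
Qed.

Lemma sum_col_block g (F : H -> A) : g \in S ->
  \sum_(h in T) F h * U h g = \sum_h F h * U h g.
Proof.
move=> gS; rewrite [RHS](bigID (mem T)) /= [X in _ + X]big1 ?addr0 // => h hT.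
by rewrite magic_block0 ?mulr0 // gS (negPf hT).
Qed.

Lemma sum_row_block1 h : h \in T -> \sum_(g in S) U h g = 1.
Proof.
have [[_ _ row _] _] := hU.
move=> hT; rewrite -(row h); under eq_bigr do rewrite -[U h _]mulr1.
by rewrite sum_row_block //; apply: eq_bigr => g _; rewrite mulr1.
Qed.

Lemma sum_col_block1 g : g \in S -> \sum_(h in T) U h g = 1.
Proof.
have [[_ _ _ col] _] := hU.
move=> gS; rewrite -(col g); under eq_bigr do rewrite -[U _ g]mul1r.
by rewrite sum_col_block //; apply: eq_bigr => h _; rewrite mul1r.
Qed.

(** Summing the block by columns gives [#|S|] times the unit, by rows [#|T|] times. *)
Lemma card_magic_block : #|S| = #|T|.
Proof.
apply: (mulrn_inj (oner_neq0 A)).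
rewrite -!sumr_const -(eq_bigr _ sum_col_block1) -(eq_bigr _ sum_row_block1).
exact: exchange_big.
Qed.

(** Entries of [U] linking [S] or [T] to an outside vertex vanish, so sums over the block equal the
    full sums. *)
Lemma quantum_iso_block : quantum_iso (induced S) (induced T) (block U T S).
Proof.
have [[_ proj _ _] UA] := hU.
split.
  split.
  - by rewrite !card_sig card_magic_block.
  - by move=> h g; apply: proj.
  - by move=> [h hT]; rewrite -(big_sub (mem S) (U h)) sum_row_block1.
  - by move=> [g gS]; rewrite -(big_sub (mem T) (U^~ g)) sum_col_block1.
move=> [h hT] [g gS]; rewrite /mulfm.
rewrite -(big_sub (mem S) (fun x => U h x * adj A x g)) sum_row_block //.
rewrite -(big_sub (mem T) (fun y => adj A h y * U y g)) sum_col_block //.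
exact: UA.
Qed.

End Block.

End QuantumIso.

Theorem theorem3p4 (R : realType) (G H : sgraph)
    (G_gt0 : (0 < #|G|)%N) (H_gt0 : (0 < #|H|)%N)
    (A : unitalCStarType R) (U : H -> G -> A) (hU : quantum_iso G H U) :
  let I : set (\bar R) := range (@ecc R G) in
  let C (i : \bar R) : {set G} := ecc_level G i in
  let D (i : \bar R) : {set H} := ecc_level H i in
  let i0 : \bar R := min_ecc R G in
  (forall i j : \bar R, I i -> I j ->
     [/\ i <> j -> block U (D i) (C j) =2 (fun _ _ => 0),
         #|C i| = #|D i|
       & quantum_iso (induced (C i)) (induced (D i)) (block U (D i) (C i))]) /\
  [/\ C i0 = center R G,
      D i0 = center R H
    & quantum_iso (induced (center R G)) (induced (center R H))
        (block U (center R H) (center R G))].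
Proof.
move=> I C D i0.
have UCD i h g : U h g != 0 -> (g \in C i) = (h \in D i).
  by move=> Uhg; rewrite !inE (ecc_quantum_iso hU Uhg).
have C0 : C i0 = center R G by apply: ecc_level_min_ecc.
(* [i0] is the minimum for [G]; it is also that for [H], as each row and column of [U] has a nonzero
   entry. *)
have D0 : D i0 = center R H.
  by rewrite /D /i0 (min_ecc_quantum_iso hU G_gt0 H_gt0) ecc_level_min_ecc.
split=> [i j _ _|].
  split; last exact (quantum_iso_block hU (UCD i)).
  - move=> ij [h hD] [g gC]; apply/eqP/negPn/negP => /(ecc_quantum_iso hU) /= eq_gh.
    by case: ij; move: hD gC; rewrite !inE => /eqP <- /eqP <-.
  - exact (card_magic_block hU (UCD i)).
by split=> //; rewrite -C0 -D0; exact (quantum_iso_block hU (UCD i0)).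
Qed.
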